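(* Let $V_A$ and $V_B$ be disjoint finite nonempty sets, let $G_K$ be the complete bipartite graph with bipartition $(V_A,V_B)$, let $G_A=(V_A,E_A)$ and $G_B=(V_B,E_B)$ be simple unweighted graphs, and let $G' = G_K\cup G_A\cup G_B$ (the graph on $V_A\cup V_B$ whose edges are those of $G_A$, those of $G_B$, and all pairs $uv$ with $u\in V_A$, $v\in V_B$). Suppose that both $G_A$ and $G_B$ contain balanced complete bipartite spanning subgraphs; that is, $|V_A|$ and $|V_B|$ are even, $G_A$ contains $K(|V_A|/2,|V_A|/2)$ as a spanning subgraph and $G_B$ contains $K(|V_B|/2,|V_B|/2)$ as a spanning subgraph. Then $G'$ is exact. Moreover, the MAXCUT SDP of such a $G'$ always has an optimal solution of rank greater than $1$.
   Context: All graphs are finite, simple and unweighted (every edge has weight $1$). $K(a,b)$ denotes the complete bipartite graph with independent sets of sizes $a$ and $b$. The Laplacian $\mathcal{L}_G$ of a graph $G=(V,E)$ with edge weights $w_{ij}$ ($w_{ij}=0$ for non-edges) is the $V\times V$ matrix with off-diagonal entries $-w_{ij}$ and diagonal entries $\sum_{j\ne i}w_{ij}$. The MAXCUT SDP of $G$ is: maximize $\frac14\langle \mathcal{L}_G,\mathbf{X}\rangle$ over symmetric matrices $\mathbf{X}\in\mathbb{R}^{V\times V}$ with $X_{ii}=1$ for all $i\in V$ and $\mathbf{X}\succeq \mathbf{0}$, where $\langle \mathbf{A},\mathbf{B}\rangle=\operatorname{tr}(\mathbf{A}\mathbf{B})$. $\mathrm{MAXCUT}(G)$ is the maximum, over partitions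 $(S,V\setminus S)$ of $V$, of the total weight of edges with exactly one endpoint in $S$. $G$ is called exact if the optimal value of the MAXCUT SDP of $G$ equals $\mathrm{MAXCUT}(G)$; equivalently, if the MAXCUT SDP has an optimal solution of rank $1$. *)

(* Defs.v *)
From mathcomp Require Import all_boot all_order all_algebra.
From mathcomp Require Import classical_sets reals.

Set Implicit Arguments.
Unset Strict Implicit.
Unset Printing Implicit Defensive.

Import Order.TTheory GRing.Theory Num.Theory.

Local Open Scope ring_scope.
Local Open Scope classical_set_scope.

Record sgraph (V : finType) := SGraph {
  adj :> rel V;
  adj_sym : symmetric adj;
  adj_irr : irreflexive adj }.

(* Disjoint vertex classes [A] and [B] are modelled by the sum type [A + B]. *)
Definition is_inl (A B : Type) (u : A + B) : bool :=
  if u is inl _ then true else false.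

Definition cbip_adj (A B : finType) : rel (A + B)%type :=
  fun u v => is_inl u != is_inl v.

Lemma cbip_adj_sym (A B : finType) : symmetric (@cbip_adj A B).
Proof. by move=> u v; rewrite /cbip_adj eq_sym. Qed.

Lemma cbip_adj_irr (A B : finType) : irreflexive (@cbip_adj A B).
Proof. by move=> u; rewrite /cbip_adj eqxx. Qed.

Definition complete_bipartite (A B : finType) : sgraph (A + B)%type :=
  SGraph (@cbip_adj_sym A B) (@cbip_adj_irr A B).

Definition Kab (a b : nat) : sgraph ('I_a + 'I_b)%type :=
  complete_bipartite 'I_a 'I_b.

Definition join_adj (A B : finType) (GA : sgraph A) (GB : sgraph B) :
    rel (A + B)%type :=
  fun u v => complete_bipartite A B u v ||
    match u, v with
    | inl x, inl y => GA x y
    | inr x, inr y => GB x y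
    | _, _ => false
    end.

Lemma join_adj_sym (A B : finType) (GA : sgraph A) (GB : sgraph B) :
  symmetric (join_adj GA GB).
Proof.
by move=> [x|x] [y|y]; rewrite /join_adj adj_sym //; congr orb; exact: adj_sym.
Qed.

Lemma join_adj_irr (A B : finType) (GA : sgraph A) (GB : sgraph B) :
  irreflexive (join_adj GA GB).
Proof. by move=> [x|x]; rewrite /join_adj !adj_irr. Qed.

Definition join_graph (A B : finType) (GA : sgraph A) (GB : sgraph B) :
    sgraph (A + B)%type :=
  SGraph (join_adj_sym GA GB) (join_adj_irr GA GB).

(* [H] is, up to isomorphism, a subgraph of [G] using every vertex of [G]. *)
Definition contains_spanning (W V : finType) (H : sgraph W) (G : sgraph V) :
    Prop :=
  exists2 f : W -> V, bijective f & forall x y, H x y -> G (f x) (f y).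

Definition has_balanced_cbip (V : finType) (G : sgraph V) : Prop :=
  ~~ odd #|V| /\ contains_spanning (Kab #|V|./2 #|V|./2) G.

Definition weight (R : realType) (V : finType) (G : sgraph V) (u v : V) : R :=
  (G u v)%:R.

(* [V x V] matrices are indexed through the enumeration [enum_val] of [V]. *)
Definition laplacian (R : realType) (V : finType) (G : sgraph V) :
    'M[R]_#|V| :=
  \matrix_(i, j)
    if i == j then \sum_(v : V | v != enum_val i) weight R G (enum_val i) v
    else - weight R G (enum_val i) (enum_val j).

Definition psd (R : realType) (n : nat) (X : 'M[R]_n) : Prop :=
  X^T = X /\ forall x : 'cV[R]_n, 0 <= (x^T *m X *m x) 0 0.

Definition sdp_feasible (R : realType) (n : nat) (X : 'M[R]_n) : Prop :=
  (forall i, X i i = 1) /\ psd X.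

Definition sdp_objective (R : realType) (V : finType) (G : sgraph V)
    (X : 'M[R]_#|V|) : R :=
  4^-1 * \tr (laplacian R G *m X).

(* The feasible set contains [1%:M] and is compact, so this supremum is a
   maximum. *)
Definition sdp_value (R : realType) (V : finType) (G : sgraph V) : R :=
  sup [set sdp_objective G X | X in [set X | sdp_feasible X]].

Definition sdp_optimal (R : realType) (V : finType) (G : sgraph V)
    (X : 'M[R]_#|V|) : Prop :=
  sdp_feasible X /\
  forall Y : 'M[R]_#|V|, sdp_feasible Y ->
    sdp_objective G Y <= sdp_objective G X.

Definition cut_weight (R : realType) (V : finType) (G : sgraph V)
    (S : {set V}) : R :=
  \sum_(u in S) \sum_(v in ~: S) weight R G u v.

(* The default value [0] is the weight of the cut given by the empty set. *)
Definition maxcut (R : realType) (V : finType) (G : sgraph V) : R :=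
  \big[Num.max/0]_(S : {set V}) cut_weight R G S.

Definition exact_graph (R : realType) (V : finType) (G : sgraph V) : Prop :=
  sdp_value R G = maxcut R G.

(* Main.v *)
Require Import Defs.
From mathcomp Require Import all_boot all_order all_algebra.
From mathcomp Require Import classical_sets reals.
From mathcomp Require Import ring lra.

Set Implicit Arguments.
Unset Strict Implicit.
Unset Printing Implicit Defensive.

Import Order.TTheory GRing.Theory Num.Theory.

Local Open Scope ring_scope.

(** The complete graph on [n] vertices has Laplacian [n *: 1%:M - J], with [J]
    the all-ones matrix, so its SDP value is at most [n ^ 2 / 4]: the trace
    part contributes [n ^ 2] and [J] only subtracts. The entries of a feasible
    [X] are at most [1], so an edge [u v] contributes [(1 - X u v) / 2 >= 0]
    and deleting edges cannot raise the objective; hence every graph on [n]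
    vertices obeys the same bound ([sdp_objective_le]).

    The bound is attained as soon as the vertices split into two halves with
    all edges between them ([full_bisection]): that cut has [(n / 2) ^ 2]
    edges. So a graph with such a split is exact ([full_bisection_exact]).

    The two halves [SA] and [~: SA] of [GA], and [SB] and [~: SB] of [GB],
    combine into such a split of the join in two essentially different ways:
    [SA] together with [SB], or [SA] together with [~: SB]. Both rank-one cut
    matrices are optimal, hence so is their midpoint. An entry of the midpoint
    between the two sides of the join averages a sign and its opposite, so it
    vanishes, which a rank-one matrix with unit diagonal does not allow. *)

(** * The upper bound on the SDP objective *)

Lemma sum_enum_val (R : nmodType) (V : finType) (F : V -> R) :
  \sum_(i < #|V|) F (enum_val i) = \sum_v F v.
Proof. by rewrite -(big_enum_val (A := V)). Qed.

Lemma sdp_objectiveE (R : realType) (V : finType) (G : sgraph V)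
    (X : 'M[R]_#|V|) :
  sdp_objective G X = 4^-1 * \sum_i \sum_j
    weight R G (enum_val i) (enum_val j) * (X i i - X j i).
Proof.
rewrite /sdp_objective /mxtrace; congr (_ * _); apply: eq_bigr => i _.
have wii : weight R G (enum_val i) (enum_val i) = 0.
  by rewrite /weight adj_irr.
have degE : \sum_(v | v != enum_val i) weight R G (enum_val i) v
    = \sum_(j < #|V|) weight R G (enum_val i) (enum_val j).
  rewrite (sum_enum_val (weight R G (enum_val i))).
  by rewrite [RHS](bigD1 (enum_val i)) //= wii add0r.
rewrite mxE (bigD1 i) //= mxE eqxx degE mulr_suml.
rewrite (bigD1 i) //= [RHS](bigD1 i) //= wii !mul0r add0r add0r -big_split /=.
apply: eq_bigr => j ne_ji; rewrite mxE eq_sym (negPf ne_ji) /=.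
by rewrite mulNr mulrBr.
Qed.

Lemma psd_entries_sum_ge0 (R : realType) (n : nat) (X : 'M[R]_n) :
  psd X -> 0 <= \sum_i \sum_j X j i.
Proof.
case=> _ /(_ (const_mx 1)); rewrite mxE.
under eq_bigr => i _ do rewrite [X in _ * X]mxE mulr1 mxE.
by under eq_bigr => i _ do under eq_bigr => j _ do rewrite !mxE mul1r.
Qed.

(** The quadratic form at the difference of two basis vectors is
    [X i i + X j j - 2 X i j]. *)
Lemma sdp_feasible_entry_le1 (R : realType) (n : nat) (X : 'M[R]_n) i j :
  sdp_feasible X -> X i j <= 1.
Proof.
case=> X1 [symX /(_ (delta_mx i 0 - delta_mx j 0))].
have entry k l : (delta_mx k 0)^T *m X *m delta_mx l (0 : 'I_1)
    = (X k l)%:M :> 'M_1.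
  by rewrite trmx_delta -rowE -colE; apply/matrixP=> a b; rewrite !ord1 !mxE.
rewrite [(_ - _)^T]linearB /= mulmxBl mulmxBl !mulmxBr !entry !mxE !mulr1n !X1.
have -> : X j i = X i j by rewrite -[in LHS]symX mxE.
by move=> ?; lra.
Qed.

Lemma sdp_objective_le (R : realType) (V : finType) (G : sgraph V)
    (X : 'M[R]_#|V|) :
  sdp_feasible X -> sdp_objective G X <= 4^-1 * #|V|%:R ^+ 2.
Proof.
move=> feasX; have [X1 psdX] := feasX.
rewrite sdp_objectiveE ler_pM2l ?invr_gt0 ?ltr0n //.
apply: (@le_trans _ _ (\sum_(i < #|V|) \sum_(j < #|V|) (1 - X j i))).
  apply: ler_sum => i _; apply: ler_sum => j _.
  have le1 := sdp_feasible_entry_le1 j i feasX.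
  rewrite X1 /weight; case: (G _ _) => /=; first by rewrite mul1r.
  by rewrite mul0r subr_ge0.
under eq_bigr => i _ do rewrite sumrB sumr_const card_ord.
rewrite sumrB sumr_const card_ord -[1 *+ _ *+ _]mulr_natr -expr2.
by rewrite gerBl psd_entries_sum_ge0.
Qed.

(** * Cuts as rank-one feasible points *)

Definition cut_sign (R : realType) (V : finType) (S : {set V}) (v : V) : R :=
  (-1) ^+ (v \in S).

Definition cut_mx (R : realType) (V : finType) (S : {set V}) : 'M[R]_#|V| :=
  let s := \col_i cut_sign R S (enum_val i) in s *m s^T.

Lemma cut_mxE (R : realType) (V : finType) (S : {set V}) i j :
  cut_mx R S i j = cut_sign R S (enum_val i) * cut_sign R S (enum_val j).
Proof. by rewrite mxE big_ord1 !mxE. Qed.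

Lemma cut_sign_sqr (R : realType) (V : finType) (S : {set V}) v :
  cut_sign R S v * cut_sign R S v = 1.
Proof. by rewrite -expr2 sqrr_sign. Qed.

Lemma cut_mx_feasible (R : realType) (V : finType) (S : {set V}) :
  sdp_feasible (cut_mx R S).
Proof.
split=> [i|]; first by rewrite cut_mxE cut_sign_sqr.
split=> [|x]; first by rewrite /cut_mx trmx_mul trmxK.
rewrite /cut_mx; set s := \col_i _.
have -> : x^T *m (s *m s^T) *m x = (s^T *m x)^T *m (s^T *m x).
  by rewrite trmx_mul trmxK !mulmxA.
by rewrite mxE big_ord1 !mxE -expr2 sqr_ge0.
Qed.

Lemma sdp_objective_cut_mx (R : realType) (V : finType) (G : sgraph V)
    (S : {set V}) :
  sdp_objective G (cut_mx R S) = cut_weight R G S.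
Proof.
pose w := weight R G.
pose c u v : R := if (u \in S) && (v \notin S) then w u v else 0.
have cutE : cut_weight R G S = \sum_u \sum_v c u v.
  rewrite /cut_weight big_mkcond; apply: eq_bigr => u _.
  rewrite /c; case: (u \in S) => /=; last by rewrite big1.
  by rewrite big_mkcond; apply: eq_bigr => v _; rewrite inE.
(* A cut edge is met twice in the double sum over vertices. *)
have termE u v :
    w u v * (1 - cut_sign R S v * cut_sign R S u) = 2 * (c u v + c v u).
  rewrite /c /cut_sign /w /weight (adj_sym G v u).
  by case: (u \in S); case: (v \in S) => /=; ring.
have -> : sdp_objective G (cut_mx R S)
    = 4^-1 * \sum_u \sum_v 2 * (c u v + c v u).
  rewrite sdp_objectiveE -[in RHS]sum_enum_val; congr (_ * _).
  apply: eq_bigr => i _; rewrite -[in RHS]sum_enum_val.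
  by apply: eq_bigr => j _; rewrite !cut_mxE cut_sign_sqr termE.
under eq_bigr => u _ do rewrite -mulr_sumr big_split /=.
rewrite -mulr_sumr big_split /= [X in _ + X]exchange_big /= -cutE.
by field.
Qed.

(** * Graphs with a full bisection *)

Definition full_bisection (V : finType) (G : sgraph V) (S : {set V}) : Prop :=
  (#|S|.*2 = #|V|)%N /\ forall u v, u \in S -> v \notin S -> G u v.

Lemma full_bisection_weight (R : realType) (V : finType) (G : sgraph V)
    (S : {set V}) :
  full_bisection G S -> cut_weight R G S = 4^-1 * #|V|%:R ^+ 2.
Proof.
case=> cardS fullS.
have cardCS : #|~: S| = #|S|.
  by apply/eqP; rewrite -(eqn_add2l #|S|) cardsC addnn cardS.
transitivity (\sum_(u in S) \sum_(v in ~: S) (1 : R)).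
  apply: eq_bigr => u Su; apply: eq_bigr => v; rewrite inE => Sv.
  by rewrite /weight fullS.
under eq_bigr => u _ do rewrite sumr_const.
rewrite sumr_const cardCS -cardS -mul2n natrM -mulr_natr.
by field.
Qed.

Lemma full_bisection_optimal (R : realType) (V : finType) (G : sgraph V)
    (S : {set V}) :
  full_bisection G S -> sdp_optimal G (cut_mx R S).
Proof.
move=> bisS; split=> [|Y feasY]; first exact: cut_mx_feasible.
by rewrite sdp_objective_cut_mx full_bisection_weight // sdp_objective_le.
Qed.

Lemma full_bisection_exact (R : realType) (V : finType) (G : sgraph V)
    (S : {set V}) :
  full_bisection G S -> exact_graph R G.
Proof.
move=> bisS; have cutS := full_bisection_weight R bisS.
transitivity (4^-1 * #|V|%:R ^+ 2 : R).
- apply/eqP; rewrite eq_le; apply/andP; split.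
    apply: ge_sup; last by move=> _ [X feasX <-]; exact: sdp_objective_le.
    by eexists; exists (cut_mx R S); first exact: cut_mx_feasible.
  rewrite -cutS -sdp_objective_cut_mx; apply: ub_le_sup.
    exists (4^-1 * #|V|%:R ^+ 2) => _ [X feasX <-].
    exact: sdp_objective_le.
  by exists (cut_mx R S) => //; exact: cut_mx_feasible.
- apply/eqP; rewrite eq_le; apply/andP; split.
    by rewrite -cutS; exact: le_bigmax.
  apply: bigmax_le => [|T _].
    by rewrite mulr_ge0 ?invr_ge0 ?ler0n ?sqr_ge0.
  by rewrite -sdp_objective_cut_mx; apply/sdp_objective_le/cut_mx_feasible.
Qed.

Lemma balanced_cbip_full_bisection (V : finType) (G : sgraph V) :
  has_balanced_cbip G -> exists S, full_bisection G S.
Proof.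
case=> evenV [f [g fK gK] edge_f].
exists [set f (inl i) | i : 'I_#|V|./2]; split.
  rewrite card_imset ?card_ord; last by move=> i j /(can_inj fK) [].
  by rewrite -[RHS]odd_double_half (negPf evenV).
move=> u v /imsetP[i _ ->]; rewrite -(gK v).
case: (g v) => [j|j] notS; last exact: edge_f.
by case/negP: notS; exact: imset_f.
Qed.

Lemma full_bisectionC (V : finType) (G : sgraph V) (S : {set V}) :
  full_bisection G S -> full_bisection G (~: S).
Proof.
case=> cardS fullS; split.
  apply/eqP; rewrite -(eqn_add2l #|S|.*2) -doubleD cardsC.
  by rewrite cardS addnn.
move=> u v; rewrite !inE negbK adj_sym => Su Sv.
exact: fullS.
Qed.

(** * The join and its second bisection *)

Definition sum_set (A B : finType) (SA : {set A}) (SB : {set B}) :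
    {set A + B} :=
  [set u | match u with inl x => x \in SA | inr y => y \in SB end].

Lemma join_full_bisection (A B : finType) (GA : sgraph A) (GB : sgraph B)
    (SA : {set A}) (SB : {set B}) :
  full_bisection GA SA -> full_bisection GB SB ->
  full_bisection (join_graph GA GB) (sum_set SA SB).
Proof.
move=> [cardSA fullSA] [cardSB fullSB]; split.
  rewrite -sum1_card big_sumType /=.
  rewrite (eq_bigl (mem SA)) => [|x]; last by rewrite inE.
  rewrite [X in (_ + X)%N](eq_bigl (mem SB)) => [|y]; last by rewrite inE.
  by rewrite !sum1_card doubleD cardSA cardSB card_sum.
move=> [x|x] [y|y]; rewrite !inE //= => Sx Sy; apply/orP; right.
- exact: fullSA.
- exact: fullSB.
Qed.

(** * Midpoints and rank *)

(** The feasible set is convex and the objective is linear. *)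
Lemma midpoint_optimal (R : realType) (V : finType) (G : sgraph V)
    (X Y : 'M[R]_#|V|) :
  sdp_optimal G X -> sdp_optimal G Y -> sdp_optimal G (2^-1 *: (X + Y)).
Proof.
move=> [[X1 [symX psdX]] optX] [feasY optY].
have [Y1 [symY psdY]] := feasY.
split; last first.
  move=> Z feasZ; apply: (le_trans (optX Z feasZ)).
  have := optX Y feasY; rewrite /sdp_objective.
  have := optY X (conj X1 (conj symX psdX)); rewrite /sdp_objective.
  rewrite -scalemxAr mxtraceZ mulmxDr mxtraceD.
  by move=> *; lra.
split=> [i|]; first by rewrite !mxE X1 Y1; field.
split=> [|x]; first by rewrite linearZ linearD /= symX symY.
rewrite -scalemxAr -scalemxAl mulmxDr mulmxDl mxE [X in _ * X]mxE.
by rewrite mulr_ge0 ?invr_ge0 ?ler0n ?addr_ge0.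
Qed.

(** Through a factorisation over a space of dimension at most one, every
    two-by-two minor vanishes; this is the minor on rows and columns [i] and
    [j]. *)
Lemma rank_le1_minor (F : fieldType) (n : nat) (X : 'M[F]_n) i j :
  (\rank X <= 1)%N -> X i i * X j j = X i j * X j i.
Proof.
rewrite -[in X in _ -> X](mulmx_base X).
move: (col_base X) (row_base X); case: (\rank X) => [|[|//]] C D _.
  by rewrite !mxE !big_ord0 mulr0.
by rewrite !mxE !big_ord1; ring.
Qed.

Theorem corollary3 (R : realType) (VA VB : finType)
    (GA : sgraph VA) (GB : sgraph VB)
    (hA0 : (0 < #|VA|)%N) (hB0 : (0 < #|VB|)%N)
    (hA : has_balanced_cbip GA) (hB : has_balanced_cbip GB) :
  exact_graph R (join_graph GA GB) /\
  exists X : 'M[R]_#|{: VA + VB}|,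
    sdp_optimal (join_graph GA GB) X /\ (1 < \rank X)%N.
Proof.
have [SA bisA] := balanced_cbip_full_bisection hA.
have [SB bisB] := balanced_cbip_full_bisection hB.
have bisS := join_full_bisection bisA bisB.
have bisT := join_full_bisection bisA (full_bisectionC bisB).
split; first exact: full_bisection_exact bisS.
set S := sum_set SA SB in bisS; set T := sum_set SA (~: SB) in bisT.
pose X : 'M[R]_#|{: VA + VB}| := 2^-1 *: (cut_mx R S + cut_mx R T).
have optX : sdp_optimal (join_graph GA GB) X.
  by apply: midpoint_optimal; exact: full_bisection_optimal.
exists X; split=> //; rewrite ltnNge; apply/negP => rankX.
have [[X1 _] _] := optX.
have /card_gt0P[a _] := hA0; have /card_gt0P[b _] := hB0.
have Xab : X (enum_rank (inl a)) (enum_rank (inr b)) = 0.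
  rewrite mxE mxE !cut_mxE !enum_rankK /cut_sign !inE.
  by case: (a \in SA); case: (b \in SB) => /=; ring.
have := rank_le1_minor (enum_rank (inl a)) (enum_rank (inr b)) rankX.
by rewrite !X1 Xab mul0r mulr1 => /eqP; rewrite oner_eq0.
Qed.
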